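(* Suppose that $S\subseteq\{0,1\}^n$. Then $S\cap Z=(S\cap\hat Z_1)\cup(S\cap Z_2)$, where $S\cap\hat Z_1$ is the set of all $x\in S$ for which there exist $\nu,\gamma\in\mathbb{R}$, $z\in\mathbb{R}^N$ and $w\in\{0,1\}^n$ such that $$\begin{aligned} &\delta\nu-\epsilon\gamma\le\frac1N\sum_{j\in[N]}z_j,\\ &-\max\left\{r_{ij}^\top x+t_{ij}^\top w+u_{ij},\,0\right\}\le-z_j-\gamma,&&\forall i\in[I],\ j\in[N],\\ &z_j\le0,&&\forall j\in[N],\\ &\left\|\begin{pmatrix}\eta_1x\\ \eta_2\end{pmatrix}\right\|_*\le\nu,\\ &w_l+x_l=1,&&\forall l\in[n],\\ &\nu\ge1,\ \gamma\ge0, \end{aligned}$$ and $$S\cap Z_2=\left\{x\in S:\ a(x)=0,\ b_i(x)\ge0,\ \forall i\in[I]\right\}.$$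
   Context: Let $n,I,N$ be positive integers, $[R]:=\{1,\dots,R\}$, $\epsilon\in(0,1)$, $\delta>0$, and let $S\subseteq\mathbb{R}^n$ be a set of deterministic constraints. Let $\eta_1,\eta_2\in\{0,1\}$ with $\eta_1+\eta_2\ge1$. For $x\in\mathbb{R}^n$ let $a(x)=\begin{pmatrix}\eta_1x\\ \eta_2\end{pmatrix}\in\mathbb{R}^{n+1}$ and, for $i\in[I]$, $b_i(x)=B_i^\top x+b^i$ with given $B_i\in\mathbb{R}^n$, $b^i\in\mathbb{R}$. The uncertain parameter $\xi=(\xi_1,\dots,\xi_I)$, $\xi_i\in\mathbb{R}^{n+1}$, takes values in $\Xi=\mathbb{R}^{I\times(n+1)}$, equipped with a norm $\|\cdot\|$ used as distance metric. It is assumed that $(\Xi,\|\cdot\|)$ is a totally bounded Polish (separable complete metric) space, i.e. for every $\hat\epsilon>0$ there exists a finite covering of $\Xi$ by balls with radius at most $\hat\epsilon$. $\|\cdot\|_*$ is the dual norm: for $a\in\mathbb{R}^{n+1}$, $\|a\|_*=\sup\{a^\top\xi_i:\ \xi\in\Xi,\ \|\xi\|\le1\}$, the value being the same for every $i\in[I]$. Samples $\zeta^1,\dots,\zeta^N\in\Xi$, $\zeta^j=(\zeta^j_1,\dots,\zeta^j_I)$, are given (i.i.d. samples from a true distribution); the empirical distribution $\mathbb{P}_{\tilde\zeta}$ gives mass $1/N$ to each $\zeta^j$, $j\in[N]$. The Wasserstein distance of probability distributions on $\Xi$ is $$W(\mathbb{P}_1,\mathbb{P}_2)=\inf\left\{\int_{\Xi\times\Xi}\|\xi_1-\xi_2\|\,\mathbb{Q}(d\xi_1,d\xi_2):\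 \mathbb{Q}\text{ a joint distribution with marginals }\mathbb{P}_1,\mathbb{P}_2\right\}$$ (here $\xi_1,\xi_2$ denote points of $\Xi$), and the ambiguity set is $\mathcal{P}=\{\mathbb{P}:\ \mathbb{P}\{\tilde\xi\in\Xi\}=1,\ W(\mathbb{P},\mathbb{P}_{\tilde\zeta})\le\delta\}$. Define $$Z=\left\{x\in\mathbb{R}^n:\ \inf_{\mathbb{P}\in\mathcal{P}}\mathbb{P}\left\{\tilde\xi:\ a(x)^\top\tilde\xi_i\le b_i(x),\ \forall i\in[I]\right\}\ge1-\epsilon\right\}.$$ For $i\in[I]$, $j\in[N]$, let $r_{ij},t_{ij}\in\mathbb{R}^n_+$ and $u_{ij}\in\mathbb{R}$ be such that $b_i(x)-a(x)^\top\zeta_i^j=r_{ij}^\top x+t_{ij}^\top w+u_{ij}$ whenever $w_l=1-x_l$ for all $l\in[n]$. Such a choice is given, with $\mathbb{I}(\cdot)$ the $0/1$ indicator and $l\in[n]$, by $$\begin{aligned} r_{ijl}&=B_{il}\mathbb{I}(B_{il}>0)-\eta_1\zeta_{il}^j\mathbb{I}(\zeta_{il}^j<0),\\ t_{ijl}&=-B_{il}\mathbb{I}(B_{il}<0)+\eta_1\zeta_{il}^j\mathbb{I}(\zeta_{il}^j>0),\\ u_{ij}&=b^i-\eta_2\zeta_{i(n+1)}^j+\sum_{\tau\in[n]}\left(B_{i\tau}\mathbb{I}(B_{i\tau}<0)-\eta_1\zeta_{i\tau}^j\mathbb{I}(\zeta_{i\tau}^j>0)\right). \end{aligned}$$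
   Formalization: Proved with the added assumption that the dual norm of a(x) is at least 1 for every x in S with a(x) nonzero (without it the claim fails, e.g. for 10 times the sup norm); total boundedness of Ξ, impossible for R^{I×(n+1)}, is dropped. *)

(* Defs.v *)
From HB Require Import structures.
From mathcomp Require Import all_boot all_order all_algebra.
From mathcomp Require Import all_classical all_reals all_analysis.
From mathcomp Require Import ring.

Set Implicit Arguments.
Unset Strict Implicit.
Unset Printing Implicit Defensive.

Import Order.TTheory GRing.Theory Num.Theory.
Import numFieldNormedType.Exports.

Local Open Scope classical_set_scope.
Local Open Scope ring_scope.

Record is_norm (R : realType) (V : lmodType R) (nrm : V -> R) : Prop := IsNorm {
  is_norm_eq0 : forall v, nrm v = 0 -> v = 0 ;
  is_normZ : forall (c : R) v, nrm (c *: v) = `|c| * nrm v ;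
  is_norm_triangle : forall v w, nrm (v + w) <= nrm v + nrm w }.

Definition dot (R : realType) (k : nat) (v w : 'cV[R]_k) : R :=
  \sum_(l < k) v l 0 * w l 0.

Definition binary (R : realType) (k : nat) : set 'cV[R]_k :=
  [set x | forall l, x l 0 = 0 \/ x l 0 = 1].

(* The space R^{m x k} with its Borel sigma-algebra.  The topology is the
   library's, which every norm on this finite-dimensional space induces. *)
Definition borel_mx (R : realType) (m k : nat) :=
  g_sigma_algebraType (@open 'M[R]_(m, k)).

(* xi_i, the i-th row of xi, as a column vector *)
Definition block (R : realType) (m k : nat) (i : 'I_m) (xi : 'M[R]_(m, k)) :
  'cV[R]_k := (row i xi)^T.

(* The dual norm is required not to depend on the block i. *)
Definition is_dual_norm (R : realType) (m k : nat)
    (nrm : 'M[R]_(m, k) -> R) (dnrm : 'cV[R]_k -> R) : Prop :=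
  forall (i : 'I_m) (a : 'cV[R]_k),
    dnrm a = sup [set dot a (block i xi) | xi in [set xi | nrm xi <= 1]].

Section Empirical.
Context d (T : measurableType d) (R : realType) (N : nat) (zeta : 'I_N -> T).
Local Open Scope ereal_scope.

Definition empirical (A : set T) : \bar R :=
  (N%:R^-1)%:E * \sum_(j < N) \d_(zeta j) A.

Let aux (k : nat) : {measure set T -> \bar R} :=
  if insub k is Some j then dirac (zeta j) else mzero.

Let empiricalE : empirical = mscale ((N%:R : R)^-1%:nng)%R (msum aux N).
Proof.
apply/funext => A; rewrite /empirical /mscale/= /msum; congr (_ * _).
by apply: eq_bigr => j _; rewrite /aux valK.
Qed.

Let empirical0 : empirical set0 = 0.
Proof. by rewrite empiricalE measure0. Qed.

Let empirical_ge0 A : 0 <= empirical A.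
Proof. by rewrite empiricalE measure_ge0. Qed.

Let empirical_sigma_additive : semi_sigma_additive empirical.
Proof. by rewrite empiricalE; exact: measure_semi_sigma_additive. Qed.

HB.instance Definition _ := isMeasure.Build d T R empirical
  empirical0 empirical_ge0 empirical_sigma_additive.

End Empirical.

Section Wasserstein.
Context d (T : measurableType d) (R : realType).
Local Open Scope ereal_scope.

Definition couplings (mu1 mu2 : {measure set T -> \bar R}) :
    set (probability (T * T)%type R) :=
  [set Q | forall A, measurable A ->
     Q (fst @^-1` A) = mu1 A /\ Q (snd @^-1` A) = mu2 A].

Definition wasserstein (dist : T -> T -> R) (mu1 mu2 : {measure set T -> \bar R})
    : \bar R :=
  ereal_inf [set \int[Q]_p (dist p.1 p.2)%:E | Q in couplings mu1 mu2].

End Wasserstein.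

(* The ball of radius delta around the empirical distribution; membership
   P{xi \in Xi} = 1 is built into the type of P. *)
Definition ambiguity_set (R : realType) (m k N : nat) (nrm : 'M[R]_(m, k) -> R)
    (delta : R) (zeta : 'I_N -> 'M[R]_(m, k)) : set (probability (borel_mx R m k) R) :=
  [set P | (@wasserstein _ (borel_mx R m k) R
              (fun xi1 xi2 : 'M[R]_(m, k) => nrm (xi1 - xi2)%R) P
              (@empirical _ (borel_mx R m k) R N zeta) <= delta%:E)%E].

Definition avec (R : realType) (n : nat) (eta1 eta2 : bool) (x : 'cV[R]_n) :
  'cV[R]_(n + 1) := col_mx (eta1%:R *: x) (const_mx eta2%:R).

Definition bfun (R : realType) (n m : nat) (B : 'I_m -> 'cV[R]_n) (b : 'I_m -> R)
    (i : 'I_m) (x : 'cV[R]_n) : R :=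
  dot (B i) x + b i.

Definition safe_event (R : realType) (n m : nat) (eta1 eta2 : bool)
    (B : 'I_m -> 'cV[R]_n) (b : 'I_m -> R) (x : 'cV[R]_n) :
    set (borel_mx R m (n + 1)) :=
  [set xi | forall i, dot (avec eta1 eta2 x) (block i xi) <= bfun B b i x].

Definition Zset (R : realType) (n m N : nat) (eps delta : R) (eta1 eta2 : bool)
    (B : 'I_m -> 'cV[R]_n) (b : 'I_m -> R) (nrm : 'M[R]_(m, n + 1) -> R)
    (zeta : 'I_N -> 'M[R]_(m, n + 1)) : set 'cV[R]_n :=
  [set x | ((1 - eps)%:E <=
     ereal_inf [set P (safe_event eta1 eta2 B b x) |
                  P in ambiguity_set nrm delta zeta])%E].

Definition Z2set (R : realType) (n m : nat) (eta1 eta2 : bool)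
    (B : 'I_m -> 'cV[R]_n) (b : 'I_m -> R) : set 'cV[R]_n :=
  [set x | avec eta1 eta2 x = 0 /\ forall i, 0 <= bfun B b i x].

(* The identity is required for all real x, not only for x in {0,1}^n. *)
Record is_decomposition (R : realType) (n m N : nat) (eta1 eta2 : bool)
    (B : 'I_m -> 'cV[R]_n) (b : 'I_m -> R) (zeta : 'I_N -> 'M[R]_(m, n + 1))
    (r t : 'I_m -> 'I_N -> 'cV[R]_n) (u : 'I_m -> 'I_N -> R) : Prop :=
  IsDecomposition {
    decomposition_r_ge0 : forall i j l, 0 <= r i j l 0 ;
    decomposition_t_ge0 : forall i j l, 0 <= t i j l 0 ;
    decomposition_eq : forall i j (x w : 'cV[R]_n),
      (forall l, w l 0 = 1 - x l 0) ->
      bfun B b i x - dot (avec eta1 eta2 x) (block i (zeta j)) =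
      dot (r i j) x + dot (t i j) w + u i j }.

Definition Z1hat (R : realType) (n m N : nat) (eps delta : R) (eta1 eta2 : bool)
    (dnrm : 'cV[R]_(n + 1) -> R)
    (r t : 'I_m -> 'I_N -> 'cV[R]_n) (u : 'I_m -> 'I_N -> R) : set 'cV[R]_n :=
  [set x | exists (nu gamma : R) (z : 'cV[R]_N) (w : 'cV[R]_n),
    binary w /\
    delta * nu - eps * gamma <= N%:R^-1 * \sum_(j < N) z j 0 /\
    (forall i j, - Num.max (dot (r i j) x + dot (t i j) w + u i j) 0
                   <= - z j 0 - gamma) /\
    (forall j, z j 0 <= 0) /\
    dnrm (avec eta1 eta2 x) <= nu /\
    (forall l, w l 0 + x l 0 = 1) /\
    1 <= nu /\ 0 <= gamma].

Section ExplicitDecomposition.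
Context (R : realType) (n m N : nat) (eta1 eta2 : bool).
Context (B : 'I_m -> 'cV[R]_n) (b : 'I_m -> R).
Context (zeta : 'I_N -> 'M[R]_(m, n + 1)).

Definition explicit_r (i : 'I_m) (j : 'I_N) : 'cV[R]_n :=
  \col_l (B i l 0 * (0 < B i l 0)%R%:R
          - eta1%:R * zeta j i (lshift 1 l) * (zeta j i (lshift 1 l) < 0)%R%:R).

Definition explicit_t (i : 'I_m) (j : 'I_N) : 'cV[R]_n :=
  \col_l (- (B i l 0 * (B i l 0 < 0)%R%:R)
          + eta1%:R * zeta j i (lshift 1 l) * (0 < zeta j i (lshift 1 l))%R%:R).

Definition explicit_u (i : 'I_m) (j : 'I_N) : R :=
  b i - eta2%:R * zeta j i (rshift n 0)
  + \sum_(l < n) (B i l 0 * (B i l 0 < 0)%R%:R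
      - eta1%:R * zeta j i (lshift 1 l) * (0 < zeta j i (lshift 1 l))%R%:R).

Lemma explicit_is_decomposition :
  is_decomposition eta1 eta2 B b zeta explicit_r explicit_t explicit_u.
Proof.
split=> [i j l|i j l|i j x w wx].
- rewrite mxE; apply: addr_ge0.
    by case: ltP => // h; rewrite ?mulr1 ?mulr0// ltW.
  rewrite -mulrA -mulrN mulr_ge0//; case: ltP => h;
    by rewrite ?mulr1 ?mulr0 ?oppr0// oppr_ge0 ltW.
- rewrite mxE; apply: addr_ge0.
    by case: ltP => h; rewrite ?mulr1 ?mulr0 ?oppr0// oppr_ge0 ltW.
  rewrite -mulrA mulr_ge0//; case: ltP => h;
    by rewrite ?mulr1 ?mulr0// ltW.
have pm (y : R) : y = y * (0 < y)%R%:R + y * (y < 0)%R%:R.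
  by case: ltgtP => [h|h|<-]; rewrite ?mulr1 ?mulr0 ?mul0r ?addr0 ?add0r.
rewrite /bfun /dot big_split_ord/= big_ord1 /avec col_mxEd /explicit_u !mxE.
rewrite [RHS]addrAC [in RHS]addrA.
have -> : \sum_l B i l 0 * x l 0 =
  \sum_l (explicit_r i j l 0 * x l 0 + explicit_t i j l 0 * w l 0
   + (B i l 0 * (B i l 0 < 0)%R%:R
      - eta1%:R * zeta j i (lshift 1 l) * (0 < zeta j i (lshift 1 l))%R%:R))
  + \sum_l col_mx (eta1%:R *: x) (const_mx eta2%:R) (lshift 1 l) 0 *
           block i (zeta j) (lshift 1 l) 0.
  rewrite -big_split/=; apply: eq_bigr => l _.
  rewrite col_mxEu !mxE wx.
  rewrite {1}[B i l 0]pm.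
  have := pm (zeta j i (lshift 1 l)).
  move: (_ < 0)%R%:R (0 < zeta _ _ _)%R%:R => p q h.
  by rewrite {4}h; ring.
by rewrite !big_split/= (_ : ord0 = 0)//; ring.
Qed.

End ExplicitDecomposition.

(* Main.v *)
Require Import Defs.
From mathcomp Require Import all_boot all_order all_algebra.
From mathcomp Require Import all_classical all_reals all_analysis.
From mathcomp Require Import measurable_realfun.
From mathcomp Require Import ring lra.

Set Implicit Arguments.
Unset Strict Implicit.
Unset Printing Implicit Defensive.

Import Order.TTheory GRing.Theory Num.Theory.
Import numFieldNormedType.Exports.

Local Open Scope classical_set_scope.
Local Open Scope ring_scope.

(** Fix a binary x, write a for the vector a(x), beta_i for b_i(x), and L for
the dual norm of a.  A point xi is safe when a . xi_i <= beta_i for every i.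

If a = 0 the safe set is the whole space or empty.  Membership of x in Z then
says that all beta_i are nonnegative (for the empty safe set, the empirical
distribution itself is a bad member of the ball), which is the second set.
The first set adds nothing: a negative beta_i makes some slack vanish at all
samples, which forces z_j <= - gamma, so that
delta nu <= - (1 - eps) gamma <= 0, against nu >= 1.

If a <> 0 then L >= 1, so nu = L is the best choice of nu, and since
w = 1 - x the number max(r_ij . x + t_ij . w + u_ij, 0) is the slack
max(beta_i - a . zeta^j_i, 0), that is, L times the distance from zeta^j to
the half-space where constraint i fails.  What has to be shown is that x is
in Z exactly when some gamma >= 0 and z <= 0 satisfy the remaining linear
constraints; such a pair is called a certificate below.

A certificate is a feasible point of the dual of the transport problem.  For
all points xi and zeta,
gamma 1_unsafe(xi) <= L |xi - zeta| + max_i (gamma - slack_i(zeta))^+,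
because going from zeta to a point that violates constraint i costs at least
slack_i(zeta) / L.  Integrating against any coupling of P with the empirical
distribution ([weak_duality]) gives
gamma P(unsafe) <= L delta - mean(z) <= eps gamma, and gamma > 0
([certificate_robustly_safe]).

Conversely, let s_j be the smallest slack at zeta^j.  If there is no
certificate, then eps gamma - mean((gamma - s_j)^+) < delta L for every
gamma >= 0.  This is the dual of a fractional knapsack problem, and its greedy
solution yields masses q_j <= 1/N with sum q_j > eps and
sum q_j s_j < delta L ([fractional_knapsack]).  Moving mass q_j from zeta^j
just across the nearest violated half-space ([near_halfspace]) costs at most
delta, so [wasserstein_transport] produces a member of the ball whose unsafe
mass exceeds eps ([robustly_safe_certificate]). *)

Lemma sum_invn (R : numFieldType) (N : nat) :
  (0 < N)%N -> \sum_(j < N) N%:R^-1 = 1 :> R.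
Proof.
move=> N_gt0; rewrite sumr_const card_ord -[LHS]mulr_natr mulVf//.
by rewrite pnatr_eq0 -lt0n.
Qed.

(** * Finitely supported measures *)

Section Atoms.
Context d (T : measurableType d) (R : realType).
Implicit Type s : seq ({nonneg R} * T).
Local Open Scope ereal_scope.

Fixpoint atoms s : {measure set T -> \bar R} :=
  if s is p :: s' then measure_add (mscale p.1 (dirac p.2)) (atoms s')
  else mzero.

Lemma atomsE s A : atoms s A = \sum_(p <- s) (p.1%:num)%:E * \d_(p.2) A.
Proof.
elim: s => [|p s ih]; first by rewrite big_nil.
by rewrite big_cons [LHS]measure_addE ih.
Qed.

Lemma ge0_integral_atoms s (f : T -> \bar R) :
  (forall x, 0 <= f x) -> measurable_fun setT f ->
  \int[atoms s]_x f x = \sum_(p <- s) (p.1%:num)%:E * f p.2.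
Proof.
move=> f0 mf; elim: s => [|p s ih].
  by rewrite big_nil /= integral_measure_zero.
rewrite big_cons /= ge0_integral_measure_add//= ih ge0_integral_mscale//=.
by rewrite integral_dirac// diracT mul1e.
Qed.

Import HBNNSimple.

(** Both integrals are suprema over the simple functions below the integrand,
and the smaller integrand has fewer of them.  Stated for arbitrary nonnegative
functions so that it applies to the transport cost of any distance. *)
Lemma ge0_integral_monotone (mu : {measure set T -> \bar R})
    (f g : T -> \bar R) :
  (forall x, 0 <= f x) -> (forall x, f x <= g x) ->
  \int[mu]_x f x <= \int[mu]_x g x.
Proof.
move=> f0 fg; rewrite !ge0_integralTE//; last first.
  by move=> x; exact: le_trans (fg x).
apply: le_ereal_sup => _ [h hf <-]; exists h => // x.
exact: le_trans (hf x) (fg x).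
Qed.

(** An inequality instead of [ge0_integral_atoms]: for an arbitrary integrand,
every simple function below [f] is below [f] at the atoms. *)
Lemma integral_atoms_le s (f : T -> \bar R) : (forall x, 0 <= f x) ->
  \int[atoms s]_x f x <= \sum_(p <- s) (p.1%:num)%:E * f p.2.
Proof.
move=> f0; rewrite ge0_integralTE//; apply: ge_ereal_sup => _ [h hf <-].
have -> : sintegral (atoms s) h = \int[atoms s]_x (h x)%:E.
  by rewrite integral_nnsfun// patch_setT.
rewrite ge0_integral_atoms//; last 2 first.
- by move=> x; rewrite lee_fin; exact: fun_ge0.
- exact/measurable_EFinP.
by apply: lee_sum => p _; apply: lee_wpmul2l; rewrite ?lee_fin// hf.
Qed.

Lemma atoms_probability s : \sum_(p <- s) (p.1%:num)%:E = 1 :> \bar R ->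
  exists P : probability T R, forall A, P A = atoms s A.
Proof.
move=> s1.
have P1 : atoms s setT = 1.
  by rewrite atomsE -s1; apply: eq_bigr => p _; rewrite diracT mule1.
case: s s1 P1 => [|p s'] s1 P1; first by move/eqP: s1; rewrite big_nil lt_eqF.
(* The total mass being 1, normalization leaves the values unchanged; it
   supplies the probability structure. *)
exists (mnormalize (atoms (p :: s')) (dirac p.2)) => A.
by rewrite /= /mnormalize/= P1 onee_eq0/= invr1 mule1.
Qed.

End Atoms.

(** * Bounds on the Wasserstein distance *)

Section WassersteinBounds.
Context d (T : measurableType d) (R : realType) (dist : T -> T -> R).
Hypothesis dist_ge0 : forall x y, 0 <= dist x y.

Lemma integral_empirical (N : nat) (zeta : 'I_N -> T) (h : T -> \bar R) :
  (forall x, 0 <= h x)%E -> measurable_fun setT h ->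
  (\int[@empirical _ T R N zeta]_x h x =
   (N%:R^-1)%:E * \sum_(j < N) h (zeta j))%E.
Proof.
move=> h0 mh; have N0 : 0 <= (N%:R^-1 : R) by rewrite invr_ge0.
pose s := [seq (NngNum N0, zeta j) | j <- index_enum 'I_N].
rewrite (eq_measure_integral (atoms s)); last first.
  move=> A _ _ /=; rewrite atomsE big_map/= /empirical.
  by rewrite ge0_sume_distrr.
rewrite ge0_integral_atoms// big_map/=.
by rewrite ge0_sume_distrr.
Qed.

(** The easy half of Kantorovich duality, in additive form: integrate
[f x <= dist x y + h y] against each coupling.  Here [h] is minus a
dual potential, kept nonnegative like [f] so that only integrals of
nonnegative functions occur. *)
Lemma weak_duality (mu1 mu2 : {measure set T -> \bar R}) (f h : T -> R) :
  measurable_fun setT f -> measurable_fun setT h ->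
  (forall x, 0 <= f x) -> (forall x, 0 <= h x) ->
  (\int[mu2]_x (h x)%:E \is a fin_num)%E ->
  (forall x y, f x <= dist x y + h y) ->
  (\int[mu1]_x (f x)%:E <=
   wasserstein dist mu1 mu2 + \int[mu2]_x (h x)%:E)%E.
Proof.
move=> mf mh f0 h0 hfin fh; rewrite -leeBlDr//.
apply: le_ereal_inf_tmp => _ [Q QC <-].
rewrite leeBlDr//.
(* The measurable minorant of the distance provided by [f] and [h]. *)
pose g (p : T * T) := Num.max (f p.1 - h p.2) 0.
have mf1 : measurable_fun setT (fun p : T * T => f p.1).
  exact: measurableT_comp mf measurable_fst.
have mh2 : measurable_fun setT (fun p : T * T => h p.2).
  exact: measurableT_comp mh measurable_snd.
have mg : measurable_fun setT g.
  apply: measurable_maxr => //; exact: measurable_funB.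
have g0 p : 0 <= g p by rewrite /g le_max lexx orbT.
have -> : (\int[mu1]_x (f x)%:E = \int[Q]_p (f p.1)%:E)%E.
  rewrite (eq_measure_integral (pushforward Q (fst : T * T -> T))).
    rewrite ge0_integral_pushforward//.
      exact/measurable_EFinP.
    by move=> y _; rewrite lee_fin.
  by move=> A mA _; rewrite -(QC A mA).1.
have -> : (\int[mu2]_x (h x)%:E = \int[Q]_p (h p.2)%:E)%E.
  rewrite (eq_measure_integral (pushforward Q (snd : T * T -> T))).
    rewrite ge0_integral_pushforward//.
      exact/measurable_EFinP.
    by move=> y _; rewrite lee_fin.
  by move=> A mA _; rewrite -(QC A mA).2.
apply: (@le_trans _ _ (\int[Q]_p ((g p)%:E + (h p.2)%:E))%E).
  apply: ge0_integral_monotone => p; rewrite ?lee_fin//.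
  by rewrite -lerBlDr /g le_max lexx.
rewrite ge0_integralD//; last 4 first.
- by move=> p _; rewrite lee_fin.
- exact/measurable_EFinP.
- by move=> p _; rewrite lee_fin.
- exact/measurable_EFinP.
rewrite leeD2r//; apply: ge0_integral_monotone => p; rewrite lee_fin//.
by rewrite /g ge_max dist_ge0 andbT lerBlDr fh.
Qed.

(** Moving mass [q j] from [zeta j] to [xi j] and leaving the rest of the
1/N in place is a coupling, and its cost bounds the distance. *)
Lemma wasserstein_transport (N : nat) (zeta xi : 'I_N -> T) (q : 'I_N -> R) :
  (0 < N)%N -> (forall x, dist x x = 0) ->
  (forall j, 0 <= q j <= N%:R^-1) ->
  exists2 P : probability T R,
    (forall A, P A = \sum_(j < N) ((N%:R^-1 - q j)%:E * \d_(zeta j) A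
                                   + (q j)%:E * \d_(xi j) A))%E
  & (wasserstein dist P (@empirical _ T R N zeta) <=
     (\sum_(j < N) q j * dist (xi j) (zeta j))%:E)%E.
Proof.
move=> N_gt0 dist0 qN.
have q0 j : 0 <= q j by case/andP: (qN j).
have q1 j : 0 <= N%:R^-1 - q j by case/andP: (qN j); rewrite subr_ge0.
(* One list of atoms, used on T for the moved distribution and on T * T for
   the coupling. *)
pose plan (U : Type) (stay move : 'I_N -> U) : seq ({nonneg R} * U) :=
  [seq (NngNum (q1 j), stay j) | j <- index_enum 'I_N] ++
  [seq (NngNum (q0 j), move j) | j <- index_enum 'I_N].
have planE (U : Type) (stay move : 'I_N -> U) (F : U -> \bar R) :
    (\sum_(p <- plan U stay move) (p.1%:num)%:E * F p.2 =
     \sum_(j < N) ((N%:R^-1 - q j)%:E * F (stay j) + (q j)%:E * F (move j)))%E.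
  by rewrite big_cat !big_map /= big_split.
have plan1 (U : Type) (stay move : 'I_N -> U) :
    (\sum_(p <- plan U stay move) (p.1%:num)%:E = 1 :> \bar R)%E.
  have := planE U stay move (fun=> 1%E).
  under eq_bigr do rewrite mule1.
  move=> ->.
  under eq_bigr do rewrite !mule1 -EFinD subrK.
  by rewrite sumEFin sum_invn.
have [P PE] := @atoms_probability _ T R (plan T zeta xi) (plan1 _ _ _).
pose plan2 := plan (T * T)%type (fun j => (zeta j, zeta j))
  (fun j => (xi j, zeta j)).
have [Q QE] := @atoms_probability _ (T * T)%type R plan2 (plan1 _ _ _).
exists P; first by move=> A; rewrite PE atomsE (planE _ _ _ (fun x => \d_x A)).
have QC : couplings P (@empirical _ T R N zeta) Q.
  move=> A mA; rewrite !QE.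
  have -> : (P : {measure set T -> \bar R}) A = atoms _ A := PE A.
  rewrite !atomsE (planE _ _ _ (fun x => \d_x A)).
  rewrite (planE _ _ _ (fun x => \d_x (fst @^-1` A))).
  rewrite (planE _ _ _ (fun x => \d_x (snd @^-1` A))).
  split; first by apply: eq_bigr => j _; rewrite !diracE.
  rewrite /= /empirical ge0_sume_distrr//; apply: eq_bigr => j _.
  transitivity
      ((N%:R^-1 - q j)%:E * \d_(zeta j) A + (q j)%:E * \d_(zeta j) A)%E.
    by rewrite !diracE.
  by rewrite -ge0_muleDl ?lee_fin// -EFinD subrK.
apply: (@le_trans _ _ (\int[Q]_p (dist p.1 p.2)%:E)%E).
  by apply: ereal_inf_lbound; exists Q.
rewrite (eq_measure_integral (atoms plan2)); last by move=> A _ _; exact: QE.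
apply: le_trans (integral_atoms_le _ _) _; first by move=> p; rewrite lee_fin.
rewrite (planE _ _ _ (fun p => (dist p.1 p.2)%:E)) -sumEFin.
by apply: lee_sum => j _; rewrite /= dist0 mule0 add0e EFinM.
Qed.

End WassersteinBounds.

(** * A fractional knapsack problem *)

Section Knapsack.
Context (R : realType) (N : nat).

(** Strong duality for the problem of collecting mass [eps] at least cost from
items of mass 1/N and unit cost [s j].  The greedy solution takes the
items in order of cost; [g], the cost of the last item touched, is the optimal
multiplier.  Taking all items cheaper than [g] and the fraction [theta]
of those of cost [g] gives mass [eps + eta] at cost [val + eta * g], where
[val] is the dual objective at [g].  Since [val < D] strictly, a small
positive excess [eta] is affordable. *)
Lemma fractional_knapsack (eps D : R) (s : 'I_N -> R) :
  (0 < N)%N -> 0 < eps < 1 -> (forall j, 0 <= s j) ->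
  (forall g, 0 <= g ->
     eps * g - N%:R^-1 * \sum_(j < N) Num.max (g - s j) 0 < D) ->
  exists q : 'I_N -> R, [/\ forall j, 0 <= q j <= N%:R^-1,
    eps < \sum_(j < N) q j & \sum_(j < N) q j * s j < D].
Proof.
move=> N_gt0 /andP[eps0 eps1] s0 dual.
have N0 : 0 < N%:R :> R by rewrite ltr0n.
have NV0 : 0 < N%:R^-1 :> R by rewrite invr_gt0.
pose mass (p : pred 'I_N) : R := \sum_(j < N | p j) N%:R^-1.
have massT : mass xpredT = 1 by exact: sum_invn.
pose heavy i := eps < mass [pred j | s j <= s i].
have [i0 hi0] : exists i, heavy i.
  pose top := [arg max_(i > Ordinal N_gt0) s i]%O.
  exists top; rewrite /heavy (_ : mass _ = 1)// -massT.
  rewrite /mass; apply: eq_bigl => j /=.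
  by rewrite /top; case: arg_maxP => // i _; exact.
have [i hi imin] : exists2 i, heavy i & forall j, heavy j -> s i <= s j.
  by case: (arg_minP s hi0) => i hi imin; exists i.
(* [g] is the smallest cost such that items of at most that cost have mass
   more than [eps]. *)
set g := s i in imin.
pose le_mass := mass [pred j | s j <= g].
pose lt_mass := mass [pred j | s j < g].
have lt_eps : lt_mass <= eps.
  have [/existsP[k0 hk0]|none] := boolP [exists k, s k < g]; last first.
    rewrite /lt_mass /mass big_pred0 ?ltW// => k /=; apply: contraNF none => ?.
    by apply/existsP; exists k.
  (* The items cheaper than [g] are those of cost at most that of the
     costliest of them, which is not heavy by minimality of [g]. *)
  case: (@arg_maxP _ _ _ k0 [pred j | s j < g] s hk0) => k /= kg kmax.
  rewrite leNgt; apply/negP => h.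
  suff /imin : heavy k by rewrite leNgt kg.
  rewrite /heavy (lt_le_trans h)// /lt_mass /mass.
  rewrite big_mkcond [leRHS]big_mkcond/=; apply: ler_sum => j _.
  case: ifPn => [/kmax ->//|_]; by case: ifP => // _; exact: ltW.
pose eq_mass := mass [pred j | s j == g].
have massE : le_mass = lt_mass + eq_mass.
  rewrite /le_mass /lt_mass /eq_mass /mass.
  rewrite big_mkcond [X in _ = X + _]big_mkcond [X in _ = _ + X]big_mkcond.
  rewrite -big_split/=.
  by apply: eq_bigr => j _; case: ltgtP; rewrite ?addr0 ?add0r.
have le_eps : eps < le_mass by [].
have eq0 : 0 < eq_mass by lra.
have g0 : 0 <= g by exact: s0.
have slack := dual g g0.
set val := (X in X < D) in slack.
(* The first bound keeps [theta <= 1]; the second makes [eta * g] at most half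
   of [D - val], with [g + 1] in place of [g] to divide by a positive number. *)
pose eta := Num.min (le_mass - eps) ((D - val) / (2 * (g + 1))).
have eta0 : 0 < eta.
  rewrite lt_min; apply/andP; split; first lra.
  by rewrite divr_gt0//; lra.
have eta1 : eta <= le_mass - eps by rewrite ge_min lexx.
have eta2 : eta * (2 * (g + 1)) <= D - val.
  by rewrite -ler_pdivlMr ?ge_min ?lexx ?orbT//; lra.
pose theta := (eps + eta - lt_mass) / eq_mass.
have theta0 : 0 <= theta by rewrite divr_ge0 ?ltW//; lra.
have theta1 : theta <= 1 by rewrite ler_pdivrMr// mul1r; lra.
have thetaE : theta * eq_mass = eps + eta - lt_mass by rewrite divfK// gt_eqF.
pose q j : R := N%:R^-1 * ((s j < g)%R%:R + theta * (s j == g)%:R).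
have qsum : \sum_(j < N) q j = eps + eta.
  rewrite -mulr_sumr big_split/= mulrDr -mulr_sumr.
  rewrite mulrCA !mulr_sumr.
  have indic (p : pred 'I_N) : \sum_(j < N) N%:R^-1 * (p j)%:R = mass p.
    rewrite /mass [RHS]big_mkcond; apply: eq_bigr => j _.
    by case: (p j); rewrite ?mulr1 ?mulr0.
  rewrite (indic [pred j | s j < g]) -mulr_sumr (indic [pred j | s j == g]).
  by rewrite -/eq_mass -/lt_mass thetaE; ring.
exists q; split.
- move=> j; rewrite /q mulr_ge0 ?(ltW NV0)//= ?addr_ge0// ?(mulr_ge0 theta0)//.
  rewrite ler_piMr ?(ltW NV0)//.
  by case: ltgtP => _; rewrite ?mulr0 ?mulr1 ?addr0 ?add0r.
- by rewrite qsum; lra.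
have -> : \sum_(j < N) q j * s j = val + eta * g.
  have -> : \sum_(j < N) q j * s j =
     g * \sum_(j < N) q j - N%:R^-1 * \sum_(j < N) Num.max (g - s j) 0.
    rewrite !mulr_sumr -sumrB; apply: eq_bigr => j _; rewrite /q.
    case: ltgtP => [lt|gt|->].
    + by rewrite max_l ?subr_ge0 ?(ltW lt)//= mulr1n mulr0n; ring.
    + by rewrite max_r ?subr_le0 ?(ltW gt)//= mulr0n; ring.
    + by rewrite subrr maxxx /= mulr1n mulr0n; ring.
  by rewrite qsum /val; ring.
have : 0 <= eta * g by rewrite mulr_ge0// ltW.
have : eta * (2 * (g + 1)) = 2 * (eta * g) + 2 * eta by ring.
lra.
Qed.

End Knapsack.

(** * Norms, linear forms and half-spaces *)

Section Norms.
Context (R : realType).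

Lemma is_norm0 (V : lmodType R) (nrm : V -> R) : is_norm nrm -> nrm 0 = 0.
Proof.
by move=> nrmP; rewrite -(scale0r 0) (is_normZ nrmP) normr0 mul0r.
Qed.

Lemma is_norm_ge0 (V : lmodType R) (nrm : V -> R) v : is_norm nrm -> 0 <= nrm v.
Proof.
move=> nrmP; have := is_norm_triangle nrmP v (- v).
by rewrite subrr (is_norm0 nrmP) -scaleN1r (is_normZ nrmP) normrN1 mul1r; lra.
Qed.

Section Block.
Context (m k : nat).
Implicit Types (xi : 'M[R]_(m, k)) (a : 'cV[R]_k).

Lemma dot_blockE a i xi : dot a (block i xi) = \sum_(l < k) a l 0 * xi i l.
Proof. by apply: eq_bigr => l _; rewrite !mxE. Qed.

Lemma dot_blockD a i xi1 xi2 :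
  dot a (block i (xi1 + xi2)) = dot a (block i xi1) + dot a (block i xi2).
Proof.
by rewrite !dot_blockE -big_split/=; apply: eq_bigr => l _; rewrite mxE mulrDr.
Qed.

Lemma dot_blockZ a i c xi : dot a (block i (c *: xi)) = c * dot a (block i xi).
Proof.
by rewrite !dot_blockE mulr_sumr; apply: eq_bigr => l _; rewrite mxE mulrCA.
Qed.

Lemma dot_block0 i xi : dot 0 (block i xi) = 0.
Proof. by rewrite dot_blockE big1// => l _; rewrite mxE mul0r. Qed.

Lemma measurable_dot_block a i :
  measurable_fun setT (fun xi : borel_mx R m k => dot a (block i xi)).
Proof.
rewrite (_ : (fun _ => _) =
    (fun xi : borel_mx R m k => \sum_(l < k) a l 0 * (xi : 'M[R]_(m, k)) i l)).
  apply: measurable_sum => l; apply: measurable_funM => //.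
  apply: (measurability _ (RGenOpens.measurableE R)).
  move=> _ [_ [x [y ->] <-]]; rewrite setTI; apply: sub_sigma_algebra.
  have /continuousP := @coord_continuous R m k i l; apply.
  exact: interval_open.
by apply/funext => xi; rewrite dot_blockE.
Qed.

Section Dual.
Context (nrm : 'M[R]_(m, k) -> R) (dnrm : 'cV[R]_k -> R).
Hypotheses (nrmP : is_norm nrm) (dnrmP : is_dual_norm nrm dnrm).

(** [sup] is 0 on sets that are empty or unbounded, so positivity of the dual
norm carries the boundedness of the linear form on the unit ball. *)
Lemma dual_has_sup a i : 0 < dnrm a ->
  has_sup [set dot a (block i xi) | xi in [set xi | nrm xi <= 1]].
Proof.
rewrite (dnrmP i) => a0; apply: contrapT => /sup_out s0.
by rewrite s0 ltxx in a0.
Qed.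

Lemma dual_norm_le a i xi : 0 < dnrm a ->
  dot a (block i xi) <= dnrm a * nrm xi.
Proof.
move=> a0; have [/(is_norm_eq0 nrmP) ->|xi0] := eqVneq (nrm xi) 0.
  rewrite (is_norm0 nrmP) mulr0 dot_blockE big1// => l _.
  by rewrite mxE mulr0.
have nxi : 0 < nrm xi by rewrite lt0r xi0 is_norm_ge0.
rewrite -ler_pdivrMr// mulrC -dot_blockZ (dnrmP i).
apply: ub_le_sup; first exact: (dual_has_sup i a0).2.
exists ((nrm xi)^-1 *: xi) => //=.
by rewrite (is_normZ nrmP) ger0_norm ?invr_ge0 ?(ltW nxi)// mulVf.
Qed.

(** Half of the formula distance = slack / dual norm for an open half-space: it
can be entered at a cost exceeding the slack by an arbitrarily small
[kappa]; moving along an almost optimal unit direction is enough. *)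
Lemma near_halfspace a i (beta kappa : R) zeta : 0 < dnrm a -> 0 < kappa ->
  exists2 xi, beta < dot a (block i xi) &
    dnrm a * nrm (xi - zeta) <=
    Num.max (beta - dot a (block i zeta)) 0 + kappa.
Proof.
move=> a0 kappa0; set gap := beta - _; set s := Num.max gap 0.
have s0 : 0 <= s by rewrite le_max lexx orbT.
have gap_s : gap <= s by rewrite le_max lexx.
have sk : 0 < s + kappa by lra.
pose c := (s + kappa) / dnrm a.
have c0 : 0 < c by exact: divr_gt0.
have [_ [v v1 <-]] : exists2 y,
    [set dot a (block i xi) | xi in [set xi | nrm xi <= 1]] y & gap / c < y.
  apply: sup_gt; last first.
    by rewrite -(dnrmP i) ltr_pdivrMr// mulrC divfK ?gt_eqF//; lra.
  exact: (dual_has_sup i a0).1.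
rewrite ltr_pdivrMr// => gap_v.
exists (zeta + c *: v).
  by rewrite dot_blockD dot_blockZ mulrC in gap_v *; rewrite /gap in gap_v; lra.
rewrite addrC addKr (is_normZ nrmP) gtr0_norm//.
rewrite mulrA [_ * c]mulrC divfK ?gt_eqF//.
by rewrite ler_piMr// ltW.
Qed.

End Dual.
End Block.
End Norms.

(** * Certificates for the distributionally robust chance constraint *)

Section ChanceConstraint.
Context (R : realType) (m k N : nat).
Context (nrm : 'M[R]_(m, k) -> R) (dnrm : 'cV[R]_k -> R).
Hypotheses (nrmP : is_norm nrm) (dnrmP : is_dual_norm nrm dnrm).
Context (zeta : 'I_N -> 'M[R]_(m, k)) (eps delta : R).
Hypotheses (m_gt0 : (0 < m)%N) (N_gt0 : (0 < N)%N).
Hypotheses (eps01 : 0 < eps < 1) (delta_gt0 : 0 < delta).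
Context (a : 'cV[R]_k) (beta : 'I_m -> R).

Definition safe : set (borel_mx R m k) :=
  [set xi | forall i, dot a (block i xi) <= beta i].

(** Up to the factor [dnrm a], the distance from [xi] to the half-space
violating constraint [i]. *)
Definition slack (xi : 'M[R]_(m, k)) i : R :=
  Num.max (beta i - dot a (block i xi)) 0.

Lemma slack_ge0 xi i : 0 <= slack xi i.
Proof. by rewrite le_max lexx orbT. Qed.

Lemma measurable_slack i :
  measurable_fun setT (fun xi : borel_mx R m k => slack xi i).
Proof.
apply: measurable_maxr => //; apply: measurable_funB => //.
exact: measurable_dot_block.
Qed.

Lemma measurable_safe : measurable safe.
Proof.
rewrite (_ : safe = \bigcap_(i in [set: 'I_m])
    ((fun xi : borel_mx R m k => dot a (block i xi)) @^-1` `]-oo, beta i])).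
  apply: fin_bigcap_measurable => // i _; rewrite -[X in measurable X]setTI.
  exact: (measurable_dot_block a i).
apply/seteqP; split=> xi /= h i; have := h i; rewrite /= in_itv/=; first by [].
exact.
Qed.

(** The constraints of the finite reformulation on [nu], [gamma] and [z], with
the slacks in place of the expressions in x and w; the lower bounds on
[nu] are kept apart. *)
Definition certificate (nu gamma : R) (z : 'I_N -> R) :=
  [/\ 0 <= gamma, forall j, z j <= 0,
      forall i j, z j + gamma <= slack (zeta j) i
    & delta * nu - eps * gamma <= N%:R^-1 * \sum_(j < N) z j].

Lemma ambiguity_set_transport (xi : 'I_N -> 'M[R]_(m, k)) (q : 'I_N -> R) :
  (forall j, 0 <= q j <= N%:R^-1) ->
  \sum_(j < N) q j * nrm (xi j - zeta j) <= delta ->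
  exists2 P, ambiguity_set nrm delta zeta P &
    (forall A, P A = \sum_(j < N)
      ((N%:R^-1 - q j)%:E * \d_(zeta j : borel_mx R m k) A +
       (q j)%:E * \d_(xi j : borel_mx R m k) A))%E.
Proof.
move=> qN cost.
have [|P PE PW] := @wasserstein_transport _ (borel_mx R m k) R
  (fun x y : 'M[R]_(m, k) => nrm (x - y)) (fun x y => is_norm_ge0 _ nrmP)
  N zeta xi q N_gt0 _ qN.
  by move=> x; rewrite subrr is_norm0.
by exists P => //; apply: le_trans PW _; rewrite lee_fin.
Qed.

Definition robustly_safe :=
  forall P, ambiguity_set nrm delta zeta P -> ((1 - eps)%:E <= P safe)%E.

(** With [gamma = 0] the left-hand side of the averaged constraint is
[delta * nu > 0], while the mean of the [z j] is at most 0. *)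
Lemma certificate_gamma_gt0 nu gamma z :
  0 < nu -> certificate nu gamma z -> 0 < gamma.
Proof.
move=> nu0 [gamma0 z0 zs zmean].
have sz : N%:R^-1 * \sum_(j < N) z j <= 0.
  by rewrite mulr_ge0_le0 ?invr_ge0// sumr_le0.
rewrite lt0r gamma0 andbT; apply/eqP => g0; move: zmean.
by rewrite g0 mulr0 subr0 leNgt (le_lt_trans sz)// mulr_gt0.
Qed.

Section Zero.
Hypothesis a0 : a = 0.

(** The safe set is everything or empty; when it is empty, the empirical
distribution (the transport of no mass) refutes robust safety because
[eps < 1]. *)
Lemma robustly_safe_zero : robustly_safe <-> forall i, 0 <= beta i.
Proof.
have [eps0 eps1] := andP eps01.
split=> [rob i|beta0 P _]; last first.
  rewrite (_ : safe = setT) ?probability_setT ?lee_fin ?gerBl ?ltW//.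
  by apply/seteqP; split=> // xi _ i; rewrite a0 dot_block0.
have [||P /rob + _] := @ambiguity_set_transport zeta (fun=> 0).
- by move=> j; rewrite lexx/= invr_ge0.
- by rewrite big1 ?ltW// => j _; rewrite mul0r.
rewrite leNgt => unsafe; rewrite leNgt; apply: contra unsafe => bi.
rewrite (_ : safe = set0) ?measure0 ?lte_fin ?subr_gt0//.
by apply/seteqP; split=> // xi /(_ i); rewrite a0 dot_block0 leNgt bi.
Qed.

(** A negative [beta i] makes slack [i] vanish at every sample, so the mean of
the [z j] is at most [- gamma < - eps * gamma]. *)
Lemma certificate_zero nu gamma z i :
  1 <= nu -> certificate nu gamma z -> 0 <= beta i.
Proof.
move=> nu1 cert.
have gamma0 := certificate_gamma_gt0 (lt_le_trans ltr01 nu1) cert.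
case: cert => _ z0 zs zmean; rewrite leNgt; apply/negP => bi.
have zg j : z j <= - gamma.
  have := zs i j; rewrite /slack a0 dot_block0 subr0 max_r ?(ltW bi)//; lra.
have : N%:R^-1 * \sum_(j < N) z j <= - gamma.
  rewrite ler_pdivrMl ?ltr0n//; apply: le_trans (ler_sum _ (fun j _ => zg j)) _.
  by rewrite sumr_const card_ord -[leLHS]mulr_natl.
have : 0 < delta * nu by rewrite mulr_gt0// (lt_le_trans ltr01 nu1).
have : eps * gamma <= gamma by rewrite ler_piMl ?ltW//; case/andP: eps01.
lra.
Qed.

End Zero.

Section Positive.
Hypothesis a_gt0 : 0 < dnrm a.

(** Weak duality with the pair (gamma / L) 1_unsafe and
(1 / L) max_i (gamma - slack_i)^+, where L is [dnrm a]; at the samples the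
latter is at most - z_j / L. *)
Lemma certificate_robustly_safe nu gamma z :
  dnrm a <= nu -> certificate nu gamma z -> robustly_safe.
Proof.
move=> a_nu cert P PW.
have gamma_gt0 := certificate_gamma_gt0 (lt_le_trans a_gt0 a_nu) cert.
case: cert => gamma0 z0 zs /(le_trans _) zmean.
have {}zmean : delta * dnrm a - eps * gamma <= N%:R^-1 * \sum_(j < N) z j.
  by apply: zmean; rewrite lerD2r ler_pM2l.
have NV0 : 0 <= N%:R^-1 :> R by rewrite invr_ge0.
have L0 : 0 <= (dnrm a)^-1 by rewrite invr_ge0 ltW.
(* Starting the maximum at 0 takes the positive parts. *)
pose deficit (xi : borel_mx R m k) : R :=
  (dnrm a)^-1 * \big[Num.max/0]_(i < m) (gamma - slack xi i).
pose loss (xi : borel_mx R m k) : R := (dnrm a)^-1 * gamma * \1_(~` safe) xi.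
have loss0 xi : 0 <= loss xi by rewrite !mulr_ge0.
have deficit0 xi : 0 <= deficit xi.
  by rewrite mulr_ge0//; exact: bigmax_ge_id.
have munsafe : measurable (~` safe).
  by apply: measurableC; exact: measurable_safe.
have mloss : measurable_fun setT loss.
  apply: measurable_funM => //; exact: measurable_indic.
have mdeficit : measurable_fun setT deficit.
  apply: measurable_funM => //; elim: (index_enum _) => [|i s ih].
    by under eq_fun do rewrite big_nil; exact: measurable_cst.
  under eq_fun do rewrite big_cons.
  apply: measurable_maxr => //; apply: measurable_funB => //.
  exact: measurable_slack.
have loss_le (xi xi' : 'M[R]_(m, k)) :
    loss xi <= nrm (xi - xi') + deficit xi'.
  have dist0 := is_norm_ge0 (xi - xi') nrmP.
  rewrite /loss indicE; have [|_] := boolP (xi \in _); last first.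
    by rewrite mulr0 addr_ge0.
  rewrite inE mulr1 => /existsNP[i /negP]; rewrite -ltNge => bi.
  rewrite -(ler_pM2l a_gt0) mulrDr !mulVKf ?gt_eqF//.
  apply: (@le_trans _ _ (dnrm a * nrm (xi - xi') + (gamma - slack xi' i))).
    suff : slack xi' i <= dnrm a * nrm (xi - xi') by lra.
    have := dual_norm_le nrmP dnrmP i (xi - xi') a_gt0.
    have : dot a (block i xi) =
        dot a (block i (xi - xi')) + dot a (block i xi').
      by rewrite -dot_blockD subrK.
    rewrite /slack ge_max mulr_ge0 ?(ltW a_gt0)// andbT; lra.
  by rewrite lerD2l; exact: le_bigmax_cond.
have int_deficit :
    (\int[@empirical _ (borel_mx R m k) R N zeta]_xi (deficit xi)%:E =
     (N%:R^-1 * \sum_(j < N) deficit (zeta j))%:E)%E.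
  rewrite integral_empirical; last 2 first.
  - by move=> xi; rewrite lee_fin.
  - exact/measurable_EFinP.
  by rewrite sumEFin EFinM.
have := @weak_duality _ (borel_mx R m k) R
  (fun x y : 'M[R]_(m, k) => nrm (x - y))
  (fun x y => is_norm_ge0 _ nrmP) P (@empirical _ (borel_mx R m k) R N zeta)
  loss deficit mloss mdeficit loss0 deficit0.
rewrite int_deficit => /(_ isT loss_le).
have -> : (\int[P]_xi (loss xi)%:E = ((dnrm a)^-1 * gamma)%:E * P (~` safe))%E.
  under eq_integral do rewrite EFinM.
  rewrite ge0_integralZl//; last 2 first.
  - apply/measurable_EFinP; exact: measurable_indic.
  - by rewrite lee_fin mulr_ge0.
  by rewrite integral_indic ?setIT.
move=> main.
have {}main : (((dnrm a)^-1 * gamma)%:E * P (~` safe) <=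
    (delta + N%:R^-1 * \sum_(j < N) deficit (zeta j))%:E)%E.
  by rewrite EFinD (le_trans main)// leeD2r.
have : \sum_(j < N) deficit (zeta j) <= (dnrm a)^-1 * (- \sum_(j < N) z j).
  rewrite -sumrN mulr_sumr; apply: ler_sum => j _; rewrite ler_wpM2l//.
  apply: bigmax_le; first by rewrite oppr_ge0.
  by move=> i _; have := zs i j; lra.
move=> /(ler_wpM2l NV0) def_z.
rewrite probability_setC in main; last exact: measurable_safe.
have Pfin : P safe \is a fin_num.
  by apply: fin_num_measure; exact: measurable_safe.
rewrite -(fineK Pfin) -EFinB -EFinM !lee_fin in main *.
set p := fine _ in main *.
have {}main := le_trans main (lerD (lexx _) def_z).
move: main; rewrite -(ler_pM2l a_gt0) !mulrDr -!mulrA.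
rewrite [_ * (N%:R^-1 * _)]mulrCA !mulVKf ?gt_eqF// => main.
rewrite -(ler_pM2l gamma_gt0); lra.
Qed.

(** If no multiplier [gamma] works with z_j = - (gamma - s_j)^+, the best
choice of z, then the knapsack solution tells how much mass to push from
each sample across its nearest violated half-space. *)
Lemma robustly_safe_certificate :
  robustly_safe -> exists gamma z, certificate (dnrm a) gamma z.
Proof.
move=> allsafe.
pose tight j := [arg min_(i < Ordinal m_gt0) slack (zeta j) i]%O.
have tightP j i : slack (zeta j) (tight j) <= slack (zeta j) i.
  by rewrite /tight; case: arg_minP => // i' _; exact.
pose s j := slack (zeta j) (tight j).
have [[gamma gamma0 le_dual]|nodual] := pselect (exists2 gamma, 0 <= gamma &
    delta * dnrm a <=
    eps * gamma - N%:R^-1 * \sum_(j < N) Num.max (gamma - s j) 0).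
  exists gamma, (fun j => - Num.max (gamma - s j) 0); split => //.
  - by move=> j; rewrite oppr_le0 le_max lexx orbT.
  - move=> i j; apply: le_trans (tightP j i); rewrite -/(s j).
    have : gamma - s j <= Num.max (gamma - s j) 0 by rewrite le_max lexx.
    lra.
  - by rewrite sumrN mulrN; lra.
have [|q [qN qeps qs]] := @fractional_knapsack R N eps (delta * dnrm a) s
    N_gt0 eps01 (fun j => slack_ge0 _ _).
  move=> gamma gamma0; rewrite ltNge; apply/negP => h.
  by apply: nodual; exists gamma.
(* The unspent budget pays for crossing the boundaries strictly; it suffices
   since the total mass moved is at most 1. *)
pose kappa := delta * dnrm a - \sum_(j < N) q j * s j.
have kappa0 : 0 < kappa by rewrite subr_gt0.
have /choice[xi xiP] : forall j, exists xi : 'M[R]_(m, k),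
    beta (tight j) < dot a (block (tight j) xi) /\
    dnrm a * nrm (xi - zeta j) <= s j + kappa.
  move=> j; have [xi h1 h2] := near_halfspace nrmP dnrmP (tight j)
    (beta (tight j)) (zeta j) a_gt0 kappa0.
  by exists xi.
have sumq : \sum_(j < N) q j <= 1.
  by rewrite -(sum_invn R N_gt0) ler_sum// => j _; case/andP: (qN j).
have [|P /allsafe + PE] := ambiguity_set_transport (xi := xi) qN.
  rewrite -(ler_pM2l a_gt0) mulr_sumr.
  apply: (@le_trans _ _ (\sum_(j < N) (q j * s j + q j * kappa))).
    apply: ler_sum => j _; rewrite mulrCA -mulrDr ler_wpM2l//.
      by case/andP: (qN j).
    exact: (xiP j).2.
  rewrite big_split/= -mulr_suml.
  have : (\sum_(j < N) q j) * kappa <= kappa by rewrite ler_piMl// ltW.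
  by rewrite {2}/kappa; lra.
rewrite PE leNgt => /negP[].
apply: (@le_lt_trans _ _ (\sum_(j < N) (N%:R^-1 - q j)%:E)%E).
  apply: lee_sum => j _.
  have -> : (\d_(xi j : borel_mx R m k) safe = 0 :> \bar R)%E.
    by rewrite diracE memNset// => /(_ (tight j)); rewrite leNgt (xiP j).1.
  rewrite mule0 adde0 diracE; case: (_ \in _); rewrite ?mule1 ?mule0// lee_fin.
  by rewrite subr_ge0; case/andP: (qN j).
by rewrite sumEFin lte_fin sumrB sum_invn//; lra.
Qed.

End Positive.
End ChanceConstraint.

(** * The reformulation on binary points *)

(* [dnrm_ge1] is automatic for the usual norms: it holds as soon as every unit
   matrix E_ik has norm at most 1, e.g. for all l_p norms.  For an arbitrary
   norm it cannot be dropped because of the constraint [1 <= nu]: take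
   n = m = N = 1, eta1 = 0, eta2 = 1, ten times the sup norm, zeta = 0, B = 0,
   b = 1, delta = 1, eps = 1/2. *)
Theorem theorem7 (R : realType) (n m N : nat)
  (n_gt0 : (0 < n)%N) (m_gt0 : (0 < m)%N) (N_gt0 : (0 < N)%N)
  (eps delta : R) (eps_gt0 : 0 < eps) (eps_lt1 : eps < 1) (delta_gt0 : 0 < delta)
  (S : set 'cV[R]_n)
  (eta1 eta2 : bool) (eta_ge1 : (1 <= eta1 + eta2)%N)
  (B : 'I_m -> 'cV[R]_n) (b : 'I_m -> R)
  (nrm : 'M[R]_(m, n + 1) -> R) (nrmP : is_norm nrm)
  (dnrm : 'cV[R]_(n + 1) -> R) (dnrmP : is_dual_norm nrm dnrm)
  (dnrm_ge1 : forall x, S x -> avec eta1 eta2 x <> 0 ->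
     1 <= dnrm (avec eta1 eta2 x))
  (zeta : 'I_N -> 'M[R]_(m, n + 1))
  (r t : 'I_m -> 'I_N -> 'cV[R]_n) (u : 'I_m -> 'I_N -> R)
  (rtuP : is_decomposition eta1 eta2 B b zeta r t u)
  (S_binary : S `<=` @binary R n) :
  S `&` Zset eps delta eta1 eta2 B b nrm zeta =
  (S `&` Z1hat eps delta eta1 eta2 dnrm r t u) `|` (S `&` Z2set eta1 eta2 B b).
Proof.
have eps01 : 0 < eps < 1 by rewrite eps_gt0.
rewrite -setIUr; apply/seteqP.
suff key x : S x -> Zset eps delta eta1 eta2 B b nrm zeta x <->
    (Z1hat eps delta eta1 eta2 dnrm r t u `|` Z2set eta1 eta2 B b) x.
  by split=> x [Sx /(key x Sx)].
move=> Sx; set a := avec eta1 eta2 x; pose beta i := bfun B b i x.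
have ZE : Zset eps delta eta1 eta2 B b nrm zeta x <->
    robustly_safe nrm zeta eps delta a beta.
  split=> [Zx P PW|Zx].
    by apply: le_trans Zx _; apply: ereal_inf_lbound; exists P.
  by apply: le_ereal_inf_tmp => _ [P PW <-]; exact: Zx.
have slackE (w : 'cV[R]_n) i j : (forall l, w l 0 + x l 0 = 1) ->
    slack a beta (zeta j) i = Num.max (dot (r i j) x + dot (t i j) w + u i j) 0.
  move=> wx; rewrite -(decomposition_eq rtuP)// => l.
  by rewrite -(wx l) addrK.
have Z1E : Z1hat eps delta eta1 eta2 dnrm r t u x <->
    exists nu gamma z, [/\ dnrm a <= nu, 1 <= nu &
      certificate zeta eps delta a beta nu gamma z].
  split.
    move=> [nu [gamma [z [w [_ [zmean [zs [z0 [a_nu [wx [nu1 gamma0]]]]]]]]]]].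
    exists nu, gamma, (fun j => z j 0); split=> //; split=> // i j.
    by rewrite (slackE w)//; have := zs i j; lra.
  move=> [nu [gamma [z [a_nu nu1 [gamma0 z0 zs zmean]]]]].
  pose w : 'cV[R]_n := \col_l (1 - x l 0).
  have wx l : w l 0 + x l 0 = 1 by rewrite mxE subrK.
  exists nu, gamma, (\col_j z j), w; split.
    by move=> l; rewrite mxE; case: (S_binary x Sx l) => ->; [right|left]; lra.
  split; first by under eq_bigr do rewrite mxE.
  split; first by move=> i j; rewrite mxE -(slackE w)//; have := zs i j; lra.
  by split=> // j; rewrite mxE.
apply: (iff_trans ZE); rewrite /setU/= Z1E.
have [a0|/eqP a0] := eqVneq a 0.
  apply: (iff_trans (robustly_safe_zero nrmP _ N_gt0 eps01 delta_gt0 _ a0)).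
  split=> [beta0|[[nu [gamma [z [_ nu1 cert]]]] i|[_ beta0]//]]; first by right.
  exact: (certificate_zero N_gt0 eps01 delta_gt0 a0 i nu1 cert).
have a1 : 1 <= dnrm a by exact: dnrm_ge1.
have a_gt0 : 0 < dnrm a by exact: lt_le_trans a1.
split=> [|[[nu [gamma [z [a_nu _]]]]|[]//]].
  move=> rob; have [gamma [z cert]] :=
    robustly_safe_certificate nrmP dnrmP m_gt0 N_gt0 eps01 a_gt0 rob.
  by left; exists (dnrm a), gamma, z.
exact: certificate_robustly_safe.
Qed.
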